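(* Let $\Theta$ be a parameter space, $\mathcal{A}$ an action space, $\mathcal{P}=\{P_\theta:\theta\in\Theta\}$ a family of probability measures on a sample space $\mathcal{X}$, $L:\Theta\times\mathcal{A}\to[0,\infty)$ a nonnegative loss function, $w$ a prior probability measure on $\Theta$, and $f:(0,\infty)\to\mathbb{R}$ a convex function with $f(1)=0$. Then $$R_{\rm Bayes}(w,L;\Theta)\;\ge\;\frac12\sup\Big\{t>0:\ \sup_{a\in\mathcal{A}}w(B_t(a,L))<1-u_f\big(I_f(w,\mathcal{P})\big)\Big\},$$ where $B_t(a,L):=\{\theta\in\Theta:L(\theta,a)<t\}$ for $a\in\mathcal{A}$ and $t>0$.
   Context: All functions and sets are assumed measurable as needed. The supremum of the empty set is taken to be $0$. The Bayes risk is $R_{\rm Bayes}(w,L;\Theta):=\inf_{\mathfrak{d}}\int_\Theta \mathbb{E}_\theta L(\theta,\mathfrak{d}(X))\,w(\mathrm{d}\theta)$, the infimum being over all decision rules $\mathfrak{d}:\mathcal{X}\to\mathcal{A}$, where $\mathbb{E}_\theta$ is expectation under $X\sim P_\theta$. For convex $f:(0,\infty)\to\mathbb{R}$ with $f(1)=0$, put $f(0):=\lim_{x\downarrow0}f(x)$ and $f'(\infty):=\lim_{x\uparrow\infty}f(x)/x$ (possibly $+\infty$). For probability measures $P,Q$ with densities $p,q$ with respect to a common measure $\mu$, $D_f(P\|Q):=\int f(p/q)\,q\,\mathrm{d}\mu+f'(\infty)P\{q=0\}$, with the convention $0\cdot\infty=0$. The $f$-informativity is $I_f(w,\mathcal{P}):=\inf_Q\int_\Theta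 D_f(P_\theta\|Q)\,w(\mathrm{d}\theta)$, the infimum being over all probability measures $Q$ on $\mathcal{X}$. For $a,b\in[0,1]$, $\phi_f(a,b)$ is the $f$-divergence $D_f(P\|Q)$ between the probability measures on $\{0,1\}$ with $P\{1\}=a$, $Q\{1\}=b$; explicitly, $\phi_f(a,b)=bf(a/b)+(1-b)f\big(\tfrac{1-a}{1-b}\big)$ if $0<b<1$; $\phi_f(a,0)=f(1-a)+af'(\infty)$; $\phi_f(a,1)=f(a)+(1-a)f'(\infty)$. The function $u_f$ takes values in $[1/2,1]$ and is defined by $u_f(x):=\inf\{1/2\le b\le1:\phi_f(1/2,b)>x\}$ for $x\ge0$, with $u_f(x):=1$ if $\phi_f(1/2,b)\le x$ for every $b\in[1/2,1]$ (in particular $u_f(\infty)=1$). *)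

(* Defs.v *)
From HB Require Import structures.
From mathcomp Require Import all_boot all_order all_algebra.
From mathcomp Require Import all_classical all_reals all_analysis measurable_realfun.

Set Implicit Arguments.
Unset Strict Implicit.
Unset Printing Implicit Defensive.

Import Order.TTheory GRing.Theory Num.Theory.
Import numFieldNormedType.Exports.

Local Open Scope classical_set_scope.
Local Open Scope ring_scope.
Local Open Scope ereal_scope.

(* The library has [ereal_sup set0 = -oo]; here the supremum of the empty set
   is 0. *)
Definition esup0 (R : realType) (S : set (\bar R)) : \bar R :=
  if `[< S = set0 >] then 0 else ereal_sup S.

Section f_divergence.
Context (R : realType).

(* Only the values of [f] on the positive reals are used below. *)
Definition f_at0 (f : R -> R) : \bar R := lim ((f x)%:E @[x --> 0%R^'+]).

Definition f'_oo (f : R -> R) : \bar R := lim ((f x / x)%:E @[x --> +oo%R]).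

Definition fext (f : R -> R) (x : R) : \bar R :=
  if (0 < x)%R then (f x)%:E else f_at0 f.

Context d (X : measurableType d).

Definition prob_add (P Q : probability X R) : set X -> \bar R :=
  measure_add P Q.

Section prob_add_finite.
Variables P Q : probability X R.

HB.instance Definition _ := Measure.on (prob_add P Q).

Let prob_add_fin : fin_num_fun (prob_add P Q).
Proof.
move=> A mA; rewrite /prob_add measure_addE fin_numD.
by rewrite !fin_num_measure.
Qed.

HB.instance Definition _ :=
  @Measure_isFinite.Build _ X R (prob_add P Q) prob_add_fin.

End prob_add_finite.

(* Density of [P] with respect to the dominating measure [mu]; this version of
   the Radon-Nikodym derivative is finite and nonnegative everywhere. *)
Definition density (mu : {sigma_finite_measure set X -> \bar R})
    (P : probability X R) (x : X) : R :=
  fine (Radon_Nikodym_SigmaFinite.f P mu x).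

(* The value of D_f does not depend on the dominating measure, which is taken
   to be P + Q.  Where q = 0 the integrand is 0, because
   [_ * 0 = 0] in [\bar R].  By convexity its negative part is integrable, so
   that the integral is well defined in ]-oo, +oo]. *)
Definition f_divergence (f : R -> R) (P Q : probability X R) : \bar R :=
  let mu := prob_add P Q in
  let p := density mu P in
  let q := density mu Q in
  \int[mu]_x (fext f (p x / q x) * (q x)%:E)
    + f'_oo f * P [set x | q x = 0%R].

End f_divergence.

Definition f_informativity (R : realType) (dT dX : measure_display)
    (Theta : measurableType dT) (X : measurableType dX) (f : R -> R)
    (w : probability Theta R) (P : Theta -> probability X R) : \bar R :=
  ereal_inf [set \int[w]_theta f_divergence f (P theta) Q
            | Q in [set: probability X R]].

(* The f-divergence between the Bernoulli laws of parameters [a] and [b]. *)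
Definition phi (R : realType) (f : R -> R) (a b : R) : \bar R :=
  if b == 0%R then fext f (1 - a) + a%:E * f'_oo f
  else if b == 1%R then fext f a + (1 - a)%:E * f'_oo f
  else b%:E * fext f (a / b) + (1 - b)%:E * fext f ((1 - a) / (1 - b)).

Definition u_f (R : realType) (f : R -> R) (x : \bar R) : R :=
  let S := [set b : R | (2^-1 <= b <= 1)%R /\ x < phi f 2^-1 b] in
  if `[< S = set0 >] then 1%R else inf S.

Definition bayes_risk (R : realType) (dT dA dX : measure_display)
    (Theta : measurableType dT) (A : measurableType dA)
    (X : measurableType dX) (P : Theta -> probability X R)
    (w : probability Theta R) (L : Theta -> A -> R) : \bar R :=
  ereal_inf [set \int[w]_theta \int[P theta]_x (L theta (delta x))%:E
            | delta in [set delta : X -> A | measurable_fun setT delta]].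

Definition loss_ball (R : realType) (Theta A : Type) (L : Theta -> A -> R)
    (t : R) (a : A) : set Theta :=
  [set theta | (L theta a < t)%R].

(* Main.v *)
Require Import Defs.
From HB Require Import structures.
From mathcomp Require Import all_boot all_order all_algebra.
From mathcomp Require Import all_classical all_reals all_analysis measurable_realfun.
From mathcomp Require Import ring lra.

Set Implicit Arguments.
Unset Strict Implicit.
Unset Printing Implicit Defensive.

Import Order.TTheory GRing.Theory Num.Theory.
Import numFieldNormedType.Exports.

Local Open Scope classical_set_scope.
Local Open Scope ring_scope.
Local Open Scope ereal_scope.

(** Fix a decision rule [delta] and a radius [t] with
    [w (B_t a) <= s < 1 - u_f(I_f)] for every action [a].  If [delta] incurs
    loss at least [t] with probability [r >= 1/2] (over [theta] drawn from [w]
    and then [x] drawn from [P theta]), Markov's inequality makes its risk at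
    least [t * r >= t / 2], so everything amounts to [r >= 1/2].

    Suppose that [r < 1/2].  If [x] is drawn from some [Q] independently of
    [theta], then Tonelli's theorem gives that the same event has probability
    [r_Q >= 1 - s], since conditionally on [x] the prior puts mass at most [s]
    on the ball around [delta x].  By definition of [u_f] there is
    [1/2 <= b < 1 - s] with [phi f (1/2) b > I_f].  The data processing
    inequality, convexity, and monotonicity of [phi f] yield
    [int D_f(P theta, Q) dw >= phi f r r_Q >= phi f (1/2) b] for every [Q], and
    the infimum over [Q] contradicts [phi f (1/2) b > I_f].

    The last chain of inequalities is obtained in one stroke by duality.  Any
    affine minorant [c x + e] of [f] bounds [D_f(P, Q)] below on an event [E]
    by [c * P E + e * Q E]; one minorant may be used on [E] and another one on
    its complement (lemma [f_divergence_ge_lines]).  This bound is affine in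
    the probabilities, so integrating it against [w] takes no convexity
    argument (lemma [expected_f_divergence_ge_lines]).  With the
    supporting lines of [f] at the two likelihood ratios [1/(2b)] and
    [1/(2(1-b))], the bound takes the value [phi f (1/2) b] at
    [(r, r_Q) = (1/2, b)]; it only grows when [r] decreases and [r_Q]
    increases, because the slopes of the supporting lines increase with the
    point of contact whereas their intercepts decrease (lemma
    [expected_f_divergence_ge_phi]).  The map [theta |-> D_f(P theta, Q)] may
    fail to be measurable, and this route needs only the monotonicity of the
    integral, which holds for arbitrary functions. *)

(** * Convex functions on the positive reals *)

Section convex_on_positive_reals.
Context (R : realType) (f : R -> R).
Hypothesis f_convex : @convex_function R R^o [set x : R | (0 < x)%R] f.

Lemma convex_three_points (x y z : R) : (0 < x)%R -> (x < y)%R -> (y < z)%R ->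
  (f y * (z - x) <= f x * (z - y) + f z * (y - x))%R.
Proof.
move=> x0 xy yz.
have zx : (0 < z - x)%R by rewrite subr_gt0 (lt_trans xy).
have t01 : (0 <= (z - y) / (z - x) <= 1)%R.
  rewrite divr_ge0 ?subr_ge0 ?ltW ?(lt_trans xy yz)//=.
  by rewrite ltr_pdivrMr// mul1r; lra.
pose t : {i01 R} := Itv01 (andP t01).1 (andP t01).2.
have xD : x \in [set x : R | (0 < x)%R] by rewrite inE.
have zD : z \in [set x : R | (0 < x)%R] by rewrite inE /=; lra.
have := f_convex t xD zD.
have -> : conv t (x : convex_lmodType R^o) (z : convex_lmodType R^o) = y.
  change ((z - y) / (z - x) * x + (1 - (z - y) / (z - x)) * z = y)%R.
  by field; rewrite gt_eqF.
change (f y <= (z - y) / (z - x) * f x + (1 - (z - y) / (z - x)) * f z ->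
  f y * (z - x) <= f x * (z - y) + f z * (y - x))%R.
move=> h.
rewrite -(ler_pdivlMr _ _ zx); apply: le_trans h _.
rewrite le_eqVlt; apply/orP; left; apply/eqP.
by field; rewrite gt_eqF.
Qed.

Lemma convex_chord_le (x y z : R) : (0 < x)%R -> (x < y)%R -> (y < z)%R ->
  ((f y - f x) / (y - x) <= (f z - f y) / (z - y))%R.
Proof.
move=> x0 xy yz; have := convex_three_points x0 xy yz.
have yx0 : (0 < y - x)%R by lra.
have zy0 : (0 < z - y)%R by lra.
move=> h; rewrite ler_pdivrMr// mulrAC ler_pdivlMr//; nra.
Qed.

(** The slope is the supremum of the slopes of the chords that end at [x0];
    by [convex_chord_le] every chord that starts at [x0] is steeper. *)
Lemma exists_supporting_line (x0 : R) : (0 < x0)%R ->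
  exists c : R, forall x, (0 < x)%R -> (f x0 + c * (x - x0) <= f x)%R.
Proof.
move=> x0_gt0.
pose S := [set (f x0 - f x) / (x0 - x) | x in [set x : R | (0 < x < x0)%R]]%R.
have S0 : S !=set0.
  by exists ((f x0 - f (x0 / 2)) / (x0 - x0 / 2))%R, (x0 / 2)%R => //=; lra.
have ubS y : (x0 < y)%R -> ubound S ((f y - f x0) / (y - x0))%R.
  by move=> x0y _ [x /= /andP[x_gt0 xx0] <-]; exact: convex_chord_le.
have hubS : has_ubound S.
  by exists ((f (x0 + 1) - f x0) / (x0 + 1 - x0))%R; apply: ubS; rewrite ltrDl.
exists (sup S) => x x_gt0.
have [xx0|x0x|->] := ltgtP x x0; last by lra.
- have : ((f x0 - f x) / (x0 - x) <= sup S)%R.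
    by apply: ub_le_sup => //; exists x => //=; rewrite x_gt0.
  by rewrite ler_pdivrMr ?subr_gt0//; lra.
- have : (sup S <= (f x - f x0) / (x - x0))%R by apply: ge_sup => //; exact: ubS.
  by rewrite ler_pdivlMr ?subr_gt0//; lra.
Qed.

Hypothesis f1 : f 1%R = 0%R.

(** As [f 1 = 0], the quotient is the slope of the chord between [1] and [x].
    Both boundary values of [f] are limits of this monotone function times
    an explicit function with a finite nonzero limit. *)
Lemma convex_slope1_le (x y : R) : (0 < x)%R -> (x <= y)%R ->
  x != 1%R -> y != 1%R -> (f x / (x - 1) <= f y / (y - 1))%R.
Proof.
move=> x0; rewrite le_eqVlt => /predU1P[->//|xy x1 y1].
(* Symmetry of the chord, for points on the left of 1. *)
have flip (z : R) : (f z / (z - 1) = (f 1 - f z) / (1 - z))%R.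
  by rewrite f1 sub0r -[(1 - z)%R]opprB invrN mulrNN.
have [ly|gy|/eqP] := ltgtP y 1%R; last by rewrite (negbTE y1).
- have := convex_three_points x0 xy ly.
  rewrite f1 !flip f1 !sub0r => h.
  by rewrite ler_pdivrMr ?subr_gt0 ?(lt_trans xy)// mulrAC ler_pdivlMr ?subr_gt0//; lra.
- have [lx|gx|/eqP] := ltgtP x 1%R; last by rewrite (negbTE x1).
    have := convex_chord_le x0 lx gy.
    by rewrite -flip f1 subr0.
  have := convex_three_points ltr01 gx xy.
  rewrite f1 => h.
  by rewrite ler_pdivrMr ?subr_gt0// mulrAC ler_pdivlMr ?subr_gt0//; lra.
Qed.

Lemma is_cvg_f_at0 : cvg ((f x)%:E @[x --> 0%R^'+]).
Proof.
pose g (x : R) := ((f x / (x - 1))%R)%:E.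
have g_nd : {in Interval (BRight 0%R) (BLeft 1%R) &,
    {homo g : n m / (n <= m)%R >-> (n <= m)%E}}.
  move=> x y; rewrite !in_itv /= => /andP[x0 x1] /andP[y0 y1] xy.
  by rewrite lee_fin convex_slope1_le// lt_eqF.
have bnd : (BRight 0%R < BLeft (1%R : R))%O by rewrite bnd_simp.
have g_cvg := nondecreasing_at_right_cvge _ bnd g_nd.
have l_cvg : (x - 1)%:E @[x --> (0%R : R)^'+] --> (- 1)%:E.
  apply: cvg_EFin; first by apply: nearW.
  rewrite -[X in _ --> X]add0r.
  apply: cvgB; last exact: cvg_cst.
  by apply: cvg_at_right_filter; exact: cvg_id.
set l := ereal_inf _ in g_cvg.
have def : (l *? (- 1)%:E).
  by rewrite mule_defE /= eqe oppr_eq0 oner_eq0/= andbF.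
have h := cvgeM def g_cvg l_cvg.
apply/cvg_ex; exists (l * (- 1)%:E).
apply: (cvg_trans _ (h _)); apply: near_eq_cvg.
near=> x.
by rewrite /g -EFinM divfK// subr_eq0 lt_eqF.
Unshelve. all: by end_near. Qed.

Lemma is_cvg_f'_oo : cvg ((f x / x)%:E @[x --> +oo%R]).
Proof.
(* Truncating at 2 keeps clear of the pole of the slope at 1 and makes the
   function monotone on the whole line. *)
pose g (x : R) := let y := Num.max x 2%R in ((f y / (y - 1))%R)%:E.
have g_nd : {homo g : n m / (n <= m)%R >-> (n <= m)%E}.
  move=> x y xy; rewrite lee_fin; apply: convex_slope1_le.
  - by rewrite lt_max ltr0n orbT.
  - by rewrite ge_max !le_max xy lexx orbT.
  - by rewrite gt_eqF// lt_max ltr1n orbT.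
  - by rewrite gt_eqF// lt_max ltr1n orbT.
have g_cvg := nondecreasing_cvge g_nd.
have l_cvg : (1 - x^-1)%:E @[x --> +oo%R] --> (1%R : R)%:E.
  apply: cvg_EFin; first by apply: nearW.
  rewrite -[X in _ --> X]subr0.
  apply: cvgB; first exact: cvg_cst.
  apply/gtr0_cvgV0; last exact: cvg_id.
  exact: nbhs_pinfty_gt.
set l := ereal_sup _ in g_cvg.
have def : (l *? 1%:E).
  by rewrite mule_defE /= eqe oner_eq0/= andbF.
have h := cvgeM def g_cvg l_cvg.
apply/cvg_ex; exists (l * 1%:E).
apply: (cvg_trans _ (h _)); apply: near_eq_cvg.
near=> x.
have x2 : (2 < x)%R by near: x; exact: nbhs_pinfty_gt.
rewrite /g (max_idPl (ltW x2)) -EFinM; congr (_%:E).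
by field; rewrite gt_eqF/=; lra.
Unshelve. all: by end_near. Qed.

Lemma supporting_line_le_f_at0 (c e : R) :
  (forall x, (0 < x)%R -> (c * x + e <= f x)%R) -> e%:E <= f_at0 f.
Proof.
move=> ce.
have l_cvg : (c * x + e)%:E @[x --> (0%R : R)^'+] --> e%:E.
  apply: cvg_EFin; first by apply: nearW.
  rewrite -[X in _ --> X]add0r.
  apply: cvgD; last exact: cvg_cst.
  rewrite -[X in _ --> X](mulr0 c).
  apply: cvgM; first exact: cvg_cst.
  by apply: cvg_at_right_filter; exact: cvg_id.
rewrite -(cvg_lim _ l_cvg)//; apply: lee_lim; first exact: cvgP l_cvg.
  exact: is_cvg_f_at0.
near=> x; rewrite lee_fin; apply: ce.
by near: x; exact: nbhs_right_gt.
Unshelve. all: by end_near. Qed.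

Lemma supporting_line_le_f'_oo (c e : R) :
  (forall x, (0 < x)%R -> (c * x + e <= f x)%R) -> c%:E <= f'_oo f.
Proof.
move=> ce.
have l_cvg : (c + e * x^-1)%:E @[x --> +oo%R] --> c%:E.
  apply: cvg_EFin; first by apply: nearW.
  rewrite -[X in _ --> X]addr0.
  apply: cvgD; first exact: cvg_cst.
  rewrite -[X in _ --> X](mulr0 e).
  apply: cvgM; first exact: cvg_cst.
  apply/gtr0_cvgV0; last exact: cvg_id.
  exact: nbhs_pinfty_gt.
rewrite -(cvg_lim _ l_cvg)//; apply: lee_lim; first exact: cvgP l_cvg.
  exact: is_cvg_f'_oo.
near=> x; rewrite lee_fin.
have x0 : (0 < x)%R by near: x; exact: nbhs_pinfty_gt.
rewrite ler_pdivlMr// mulrDl divfK ?gt_eqF//; exact: ce.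
Unshelve. all: by end_near. Qed.

End convex_on_positive_reals.

(** * Monotonicity of the integral without measurability *)

Section integral_monotonicity.
Context d (T : measurableType d) (R : realType) (mu : {measure set T -> \bar R}).

(** The integral of a nonnegative function is a supremum over the simple
    functions below it, and is thus monotone for arbitrary functions. *)
Lemma ge0_le_integral_nonmeasurable (f g : T -> \bar R) :
  (forall x, 0 <= f x) -> (forall x, f x <= g x) ->
  \int[mu]_x f x <= \int[mu]_x g x.
Proof.
move=> f0 fg.
have g0 x : 0 <= g x by exact: le_trans (f0 x) (fg x).
rewrite !ge0_integralTE//; apply: le_ereal_sup => _ [h hf <-].
by exists h => // x; exact: le_trans (hf x) (fg x).
Qed.

Lemma le_integral_nonmeasurable (f g : T -> \bar R) :
  (forall x, f x <= g x) -> \int[mu]_x f x <= \int[mu]_x g x.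
Proof.
move=> fg; rewrite [leLHS]integralE [leRHS]integralE; apply: leeB.
  apply: ge0_le_integral_nonmeasurable => // x.
  by rewrite !funeposE ge_max !le_max fg lexx orbT.
apply: ge0_le_integral_nonmeasurable => // x.
by rewrite !funenegE ge_max !le_max leeN2 fg lexx orbT.
Qed.

End integral_monotonicity.

(** * Densities *)

Section density_theory.
Context (R : realType) d (X : measurableType d).
Variables (mu : {sigma_finite_measure set X -> \bar R}) (P : probability X R).
Hypothesis P_mu : P `<< mu.

Lemma density_ge0 x : (0 <= density mu P x)%R.
Proof. by rewrite fine_ge0// Radon_Nikodym_SigmaFinite.f_ge0. Qed.

Lemma EFin_density x :
  (density mu P x)%:E = Radon_Nikodym_SigmaFinite.f P mu x.
Proof. by rewrite fineK// Radon_Nikodym_SigmaFinite.f_fin_num. Qed.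

Lemma density_integrable : mu.-integrable setT (fun x => (density mu P x)%:E).
Proof.
have -> : (fun x => (density mu P x)%:E) = Radon_Nikodym_SigmaFinite.f P mu.
  by apply/funext => x; rewrite EFin_density.
exact: Radon_Nikodym_SigmaFinite.f_integrable.
Qed.

Lemma density_measurable : measurable_fun setT (density mu P).
Proof. by apply/measurable_EFinP; case/integrableP: density_integrable. Qed.

Lemma integral_density (A : set X) : measurable A ->
  \int[mu]_(x in A) (density mu P x)%:E = P A.
Proof.
move=> mA; rewrite (Radon_Nikodym_SigmaFinite.f_integral P_mu mA).
by apply: eq_integral => x _; rewrite EFin_density.
Qed.

End density_theory.

Lemma integral_density_lincomb (R : realType) d (X : measurableType d)
    (mu : {sigma_finite_measure set X -> \bar R}) (P Q : probability X R)
    (c e : R) (A : set X) : P `<< mu -> Q `<< mu -> measurable A ->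
  let g x := (c * density mu P x + e * density mu Q x)%:E in
  mu.-integrable A g /\ \int[mu]_(x in A) g x = c%:E * P A + e%:E * Q A.
Proof.
move=> P_mu Q_mu mA g.
have intP : mu.-integrable A (fun x => (density mu P x)%:E).
  by apply: (integrableS measurableT) => //; exact: density_integrable.
have intQ : mu.-integrable A (fun x => (density mu Q x)%:E).
  by apply: (integrableS measurableT) => //; exact: density_integrable.
have -> : g = (fun x => c%:E * (density mu P x)%:E + e%:E * (density mu Q x)%:E).
  by apply/funext => x; rewrite /g EFinD !EFinM.
split; first by apply: integrableD => //; exact: integrableZl.
rewrite integralD//; [|exact: integrableZl..].
by rewrite !integralZl// !integral_density.
Qed.

Section prob_add_dominates.
Context (R : realType) d (X : measurableType d) (P Q : probability X R).

Lemma prob_add_dominatesl : P `<< prob_add P Q.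
Proof.
move=> N PQN A mA AN; have := PQN A mA AN.
rewrite /prob_add measure_addE => /eqP; rewrite padde_eq0//.
by case/andP => /eqP.
Qed.

Lemma prob_add_dominatesr : Q `<< prob_add P Q.
Proof.
move=> N PQN A mA AN; have := PQN A mA AN.
rewrite /prob_add measure_addE => /eqP; rewrite padde_eq0//.
by case/andP => _ /eqP.
Qed.

End prob_add_dominates.

(** * Affine lower bounds for the f-divergence *)

Section f_divergence_lower_bound.
Context (R : realType) (f : R -> R).
Hypothesis f_convex : @convex_function R R^o [set x : R | (0 < x)%R] f.
Hypothesis f1 : f 1%R = 0%R.

(** For [p > 0] this is the minorant at [p / q] scaled by [q]; for [p = 0] it
    survives the passage to the limit at [0]. *)
Lemma fext_perspective_ge (c e p q : R) :
  (forall x, (0 < x)%R -> (c * x + e <= f x)%R) ->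
  (0 <= p)%R -> (0 < q)%R -> (c * p + e * q)%:E <= fext f (p / q) * q%:E.
Proof.
move=> ce p0 q0; rewrite /fext.
have [p0'|] := ltP 0%R p.
  rewrite divr_gt0// -EFinM lee_fin.
  have -> : (c * p + e * q = (c * (p / q) + e) * q)%R.
    by field; rewrite gt_eqF.
  by rewrite ler_pM2r//; apply: ce; exact: divr_gt0.
move=> p_le0; have -> : p = 0%R by apply/eqP; rewrite eq_le p0 p_le0.
rewrite mul0r ltxx mulr0 add0r EFinM.
apply: lee_wpmul2r; first by rewrite lee_fin ltW.
exact: (supporting_line_le_f_at0 f_convex f1 ce).
Qed.

Context d (X : measurableType d) (P Q : probability X R).

Let regroup_mass (c1 e1 c2 e2 : R) (a a' b b' r s : \bar R) :
    a \is a fin_num -> a' \is a fin_num -> b \is a fin_num ->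
    b' \is a fin_num -> r \is a fin_num -> s \is a fin_num ->
  c1%:E * (a + r) + e1%:E * a' + (c2%:E * (b + s) + e2%:E * b') =
  c1%:E * a + e1%:E * a' + (c2%:E * b + e2%:E * b') + (c1%:E * r + c2%:E * s).
Proof.
move: a a' b b' r s => [a||] [a'||] [b||] [b'||] [r||] [s||] //= _ _ _ _ _ _.
by congr (_%:E); ring.
Qed.

(** The density part of the divergence is bounded pointwise where [q <> 0]; the
    mass that [P] puts on [q = 0] is weighted by [f'_oo f], which is at least
    the slope of every affine minorant of [f]. *)
Lemma f_divergence_ge_lines (c1 e1 c2 e2 : R) (E : set X) : measurable E ->
  (forall x, (0 < x)%R -> (c1 * x + e1 <= f x)%R) ->
  (forall x, (0 < x)%R -> (c2 * x + e2 <= f x)%R) ->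
  c1%:E * P (~` E) + e1%:E * Q (~` E) + (c2%:E * P E + e2%:E * Q E)
    <= f_divergence f P Q.
Proof.
move=> mE line1 line2; rewrite /f_divergence.
set mu := prob_add P Q; set p := density mu P; set q := density mu Q.
have P_mu : P `<< prob_add P Q by exact: prob_add_dominatesl.
have Q_mu : Q `<< prob_add P Q by exact: prob_add_dominatesr.
pose N := [set x | q x = 0%R].
have mq : measurable_fun setT q by exact: density_measurable.
have mN : measurable N.
  by have := mq measurableT [set 0%R] (measurable_set1 _); rewrite setTI.
have QN : Q N = 0.
  rewrite -(integral_density Q_mu)//.
  by apply: integral0_eq => x; rewrite /N /= /q => ->.
pose B1 := ~` E `\` N; pose B2 := E `\` N.
have mB1 : measurable B1 by apply: measurableD => //; exact: measurableC.
have mB2 : measurable B2 by apply: measurableD.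
pose g1 x := (c1 * p x + e1 * q x)%:E; pose g2 x := (c2 * p x + e2 * q x)%:E.
have [int1 val1] := integral_density_lincomb c1 e1 P_mu Q_mu mB1.
have [int2 val2] := integral_density_lincomb c2 e2 P_mu Q_mu mB2.
have restr_le x : (g1 \_ B1) x + (g2 \_ B2) x <= fext f (p x / q x) * (q x)%:E.
  rewrite !patchE.
  have p_ge0 : (0 <= p x)%R by exact: density_ge0.
  have q_ge0 : (0 <= q x)%R by exact: density_ge0.
  have [qx0|qx0] := eqVneq (q x) 0%R.
    by rewrite !memNset ?qx0 ?mule0 ?adde0//; case.
  have q_gt0 : (0 < q x)%R by rewrite lt_def qx0.
  have [Ex|nEx] := pselect (E x).
    rewrite memNset; last by case.
    rewrite mem_set; last by split => //; exact/eqP.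
    by rewrite add0e; exact: fext_perspective_ge.
  rewrite mem_set; last by split => //; exact/eqP.
  rewrite memNset; last by case.
  by rewrite adde0; exact: fext_perspective_ge.
have int_ge : c1%:E * P B1 + e1%:E * Q B1 + (c2%:E * P B2 + e2%:E * Q B2) <=
    \int[mu]_x (fext f (p x / q x) * (q x)%:E).
  rewrite -val1 -val2 (integral_mkcond B1) (integral_mkcond B2).
  rewrite -integralD//; last 2 first.
    exact/(integrable_mkcond _ mB1).
    exact/(integrable_mkcond _ mB2).
  exact: le_integral_nonmeasurable.
have QD (A : set X) : measurable A -> Q (A `\` N) = Q A.
  move=> mA; rewrite measureD//; last by rewrite ltey_eq fin_num_measure.
  rewrite [X in _ - X](_ : _ = 0) ?sube0//; apply/eqP.
  by rewrite eq_le measure_ge0 andbT -QN le_measure// inE//; exact: measurableI.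
have PD (A : set X) : measurable A -> P A = P (A `\` N) + P (A `&` N).
  by move=> mA; exact: measureDI.
have mEC : measurable (~` E) by exact: measurableC.
rewrite (PD _ mE) (PD _ mEC) -(QD _ mE) -(QD _ mEC).
have PN : P N = P (~` E `&` N) + P (E `&` N).
  by rewrite (measureDI P mN mE) setDE [N `&` E]setIC [N `&` ~` E]setIC.
have tail_ge (c e : R) (A : set X) : measurable A ->
    (forall x, (0 < x)%R -> (c * x + e <= f x)%R) ->
    c%:E * P (A `&` N) <= f'_oo f * P (A `&` N).
  by move=> mA ce; rewrite lee_wpmul2r// (supporting_line_le_f'_oo f_convex f1 ce).
have -> : f'_oo f * P N = f'_oo f * P (~` E `&` N) + f'_oo f * P (E `&` N).
  by rewrite PN ge0_muleDr.
rewrite regroup_mass; first last.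
- by rewrite fin_num_measure//; exact: measurableI.
- by rewrite fin_num_measure//; exact: measurableI.
- by rewrite fin_num_measure.
- by rewrite fin_num_measure.
- by rewrite fin_num_measure.
- by rewrite fin_num_measure.
apply: leeD => //; apply: leeD.
  exact: tail_ge line1.
exact: tail_ge line2.
Qed.

End f_divergence_lower_bound.

(** * Expectations under a probability measure *)

Section expectation.
Context (R : realType) d (T : measurableType d) (w : probability T R).

Lemma integrable_probability (g : T -> \bar R) : measurable_fun setT g ->
  (forall y, 0 <= g y <= 1) -> w.-integrable setT g.
Proof.
move=> mg g01; apply: (le_integrable measurableT mg (g := cst 1)) => //.
  move=> x _ /=; have /andP[g0 g1] := g01 x.
  by rewrite (gee0_abs g0) normr1.
by apply: finite_measure_integrable_cst.
Qed.

Lemma expectation_affine (a0 a1 a2 : R) (g h : T -> \bar R) :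
    measurable_fun setT g -> measurable_fun setT h ->
    (forall y, 0 <= g y <= 1) -> (forall y, 0 <= h y <= 1) ->
  \int[w]_y (a0%:E + a1%:E * g y + a2%:E * h y) =
  a0%:E + a1%:E * \int[w]_y g y + a2%:E * \int[w]_y h y.
Proof.
move=> mg mh g01 h01.
have ig := integrable_probability mg g01.
have ih := integrable_probability mh h01.
have ic : w.-integrable setT (cst a0%:E) by exact: finite_measure_integrable_cst.
have iag : w.-integrable setT (fun y => a1%:E * g y) by exact: integrableZl.
have iah : w.-integrable setT (fun y => a2%:E * h y) by exact: integrableZl.
rewrite integralD//; last exact: integrableD.
rewrite integralD// !integralZl// integral_cst//.
congr (_ + _ + _); rewrite -[RHS]mule1; congr (_ * _).
exact: probability_setT.
Qed.

End expectation.

(** * Divergence bounds averaged over the prior *)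

Section statistical_experiment.
Context (R : realType) (dT dX : measure_display).
Context (Theta : measurableType dT) (X : measurableType dX).
Context (P : Theta -> probability X R).
Hypothesis P_meas : forall U : set X, measurable U ->
  measurable_fun [set: Theta] (fun theta => P theta U).

Lemma measurable_prob_xsection (E : set (Theta * X)) : measurable E ->
  measurable_fun setT (fun theta => P theta (xsection E theta)).
Proof.
move=> mE.
pose k0 (theta : Theta) : {measure set X -> \bar R} := P theta.
pose mk := isKernel.Build _ _ Theta X R k0 P_meas.
pose k1 : R.-ker Theta ~> X := HB.pack k0 mk.
have k1T x : k1 x setT = 1 by exact: probability_setT.
pose mp := Kernel_isProbability.Build _ _ Theta X R k1 k1T.
pose k2 : R.-pker Theta ~> X := HB.pack k0 mk mp.
apply: (measurable_fun_xsection_finite_kernel k2).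
by rewrite inE.
Qed.

Context (w : probability Theta R).
Context (f : R -> R).
Hypothesis f_convex : @convex_function R R^o [set x : R | (0 < x)%R] f.
Hypothesis f1 : f 1%R = 0%R.

(** [r] and [s] are the probabilities of [E] under the joint law of
    [(theta, x)] and under the product law [w x Q]. *)
Lemma expected_f_divergence_ge_lines (Q : probability X R) (E : set (Theta * X))
    (c1 e1 c2 e2 r s : R) : measurable E ->
  (forall x, (0 < x)%R -> (c1 * x + e1 <= f x)%R) ->
  (forall x, (0 < x)%R -> (c2 * x + e2 <= f x)%R) ->
  \int[w]_theta P theta (xsection E theta) = r%:E ->
  \int[Q]_x w (ysection E x) = s%:E ->
  (c1 * (1 - r) + e1 * (1 - s) + (c2 * r + e2 * s))%:E
    <= \int[w]_theta f_divergence f (P theta) Q.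
Proof.
move=> mE line1 line2 Er Es.
have prob01 (S : probability X R) (A : set X) : measurable A -> 0 <= S A <= 1.
  by move=> mA; rewrite measure_ge0 probability_le1.
have mEx theta : measurable (xsection E theta) by exact: measurable_xsection.
have Es' : \int[w]_theta Q (xsection E theta) = s%:E.
  have := @indic_fubini_tonelli _ _ _ _ R w Q E mE.
  by rewrite indic_fubini_tonelli_FE// indic_fubini_tonelli_GE// Es.
have mQ : measurable_fun setT (fun theta => Q (xsection E theta)).
  exact: measurable_fun_xsection.
have mP := measurable_prob_xsection mE.
rewrite (_ : _%:E = \int[w]_theta ((c1 + e1)%:E
    + (c2 - c1)%:E * P theta (xsection E theta)
    + (e2 - e1)%:E * Q (xsection E theta))); last first.
  rewrite expectation_affine//; [|by move=> ?; exact: prob01..].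
  by rewrite Er Es' -!EFinM -!EFinD; congr (_%:E); ring.
apply: le_integral_nonmeasurable => theta.
apply: le_trans (f_divergence_ge_lines f_convex f1 _ Q (mEx theta) line1 line2).
rewrite !probability_setC//.
have : P theta (xsection E theta) \is a fin_num by rewrite fin_num_measure.
have : Q (xsection E theta) \is a fin_num by rewrite fin_num_measure.
case: (P theta _) => [a||]//; case: (Q _) => [a'||]// _ _.
rewrite le_eqVlt; apply/orP; left; apply/eqP.
by congr (_%:E); ring.
Qed.

(** The lines are chosen to be tight at [(r, s) = (1/2, b)]: in the expression
    of [phi f (1/2) b], [f] is evaluated at [x2 = 1/(2b)] for the event [E] and
    at [x1 = 1/(2(1-b))] for its complement.  The hypothesis [b >= 1/2] gives
    [x2 <= 1 <= x1]. *)
Lemma expected_f_divergence_ge_phi (Q : probability X R) (E : set (Theta * X))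
    (b r s : R) : (2^-1 <= b < 1)%R -> measurable E ->
  \int[w]_theta P theta (xsection E theta) = r%:E ->
  \int[Q]_x w (ysection E x) = s%:E ->
  (r <= 2^-1)%R -> (b <= s)%R ->
  phi f 2^-1 b <= \int[w]_theta f_divergence f (P theta) Q.
Proof.
move=> /andP[b_ge b_lt] mE Er Es r_le s_ge.
have b0 : (0 < b)%R by apply: lt_le_trans b_ge; rewrite invr_gt0.
pose x1 : R := (2^-1 / (1 - b))%R; pose x2 : R := (2^-1 / b)%R.
have x1_gt0 : (0 < x1)%R by rewrite divr_gt0 ?subr_gt0// invr_gt0.
have x2_gt0 : (0 < x2)%R by rewrite divr_gt0// invr_gt0.
have x2_le1 : (x2 <= 1)%R by rewrite ler_pdivrMr// mul1r.
have x1_ge1 : (1 <= x1)%R by rewrite ler_pdivlMr ?subr_gt0//; lra.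
(* One slope per point: for b = 1/2 the two points coincide, and the lines
   must then coincide too. *)
have [c line] : exists c : R -> R, forall x0 x : R, (0 < x0)%R -> (0 < x)%R ->
    (f x0 + c x0 * (x - x0) <= f x)%R.
  have /choice[c cP] : forall x0 : R, exists c, (0 < x0)%R ->
      forall x : R, (0 < x)%R -> (f x0 + c * (x - x0) <= f x)%R.
    move=> x0; have [x0_gt0|] := boolP (0 < x0)%R; last by exists 0%R.
    by have [c cP] := exists_supporting_line f_convex x0_gt0; exists c.
  by exists c => x0 x x0_gt0; exact: cP.
pose c1 := c x1; pose c2 := c x2.
have line1 x : (0 < x)%R -> (f x1 + c1 * (x - x1) <= f x)%R by exact: line.
have line2 x : (0 < x)%R -> (f x2 + c2 * (x - x2) <= f x)%R by exact: line.
pose e1 := (f x1 - c1 * x1)%R; pose e2 := (f x2 - c2 * x2)%R.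
have line1' x : (0 < x)%R -> (c1 * x + e1 <= f x)%R.
  by move=> /line1; rewrite /e1; lra.
have line2' x : (0 < x)%R -> (c2 * x + e2 <= f x)%R.
  by move=> /line2; rewrite /e2; lra.
have h12 := line1 _ x2_gt0.
have h21 := line2 _ x1_gt0.
have c21 : (c2 <= c1)%R.
  have : (x2 <= x1)%R by exact: le_trans x1_ge1.
  rewrite le_eqVlt => /predU1P[x12|x21]; first by rewrite /c1 /c2 x12.
  rewrite -(ler_pM2r (_ : 0 < x1 - x2)%R) ?subr_gt0//; lra.
have e12 : (e1 <= e2)%R.
  have : (c2 * x2 <= c1 * x2)%R by rewrite ler_pM2r.
  by rewrite /e1 /e2; lra.
apply: le_trans (expected_f_divergence_ge_lines mE line1' line2' Er Es).
rewrite /phi gt_eqF// lt_eqF// /fext.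
have -> : ((1 - 2^-1) / (1 - b) = x1 :> R)%R by rewrite /x1; congr (_ / _)%R; lra.
rewrite -/x2 x1_gt0 x2_gt0 -!EFinM -EFinD lee_fin.
have -> : f x1 = (c1 * x1 + e1)%R by rewrite /e1; lra.
have -> : f x2 = (c2 * x2 + e2)%R by rewrite /e2; lra.
have -> : (b * (c2 * x2 + e2) + (1 - b) * (c1 * x1 + e1) =
  c2 * 2^-1 + b * e2 + (c1 * 2^-1 + (1 - b) * e1))%R.
  rewrite /x1 /x2; field; apply/andP; split; rewrite gt_eqF//; lra.
nra.
Qed.

End statistical_experiment.

(** * Suprema with value zero on the empty set *)

Lemma esup0_le (R : realType) (S : set (\bar R)) (y : \bar R) :
  0 <= y -> ubound S y -> esup0 S <= y.
Proof. by move=> y0 Sy; rewrite /esup0; case: asboolP => // _; exact: ge_ereal_sup. Qed.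

Lemma esup0_ubound (R : realType) (S : set (\bar R)) : ubound S (esup0 S).
Proof.
move=> x Sx; rewrite /esup0; case: asboolP => [S0|_]; first by rewrite S0 in Sx.
exact: ereal_sup_ubound.
Qed.

Lemma esup0_ge0 (R : realType) (S : set (\bar R)) :
  (forall x, S x -> 0 <= x) -> 0 <= esup0 S.
Proof.
move=> S_ge0; have [->|/set0P[x Sx]] := eqVneq S set0.
  by rewrite /esup0 asboolT.
exact: le_trans (S_ge0 x Sx) (esup0_ubound Sx).
Qed.

(** * Bayes risk *)

(** When no [b] exceeds the threshold [I], [u_f] is [1] and the strict
    inequality is impossible for [s >= 0].  Otherwise [u_f] is an infimum
    smaller than [1 - s], so that some admissible [b] lies below [1 - s]; the
    endpoint [b = 1], where [phi] involves [f'_oo], is thus excluded. *)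
Lemma u_f_lt_exists (R : realType) (f : R -> R) (I s : \bar R) :
  0 <= s -> s < 1 - (u_f f I)%:E ->
  exists b : R, [/\ (2^-1 <= b < 1)%R, I < phi f 2^-1 b & s <= (1 - b)%:E].
Proof.
move=> s_ge0 s_lt; move: (s_lt).
have : u_f f I = u_f f I by [].
rewrite {2}/u_f; case: asboolP => [_ ->|/eqP/set0P S_neq0 uE].
  by rewrite subee// ltNge s_ge0.
move: s s_ge0 {s_lt} => [s||] s_ge0 //.
rewrite -EFinB lte_fin uE => s_lt.
have : (inf [set b : R | (2^-1 <= b <= 1)%R /\ (I < phi f 2^-1 b)%E] < 1 - s)%R.
  by lra.
move=> /(inf_lt S_neq0)[b [/andP[b_ge b_le1] Ib] b_lt].
rewrite lee_fin in s_ge0.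
exists b; split => //; last by rewrite lee_fin; lra.
by rewrite b_ge/=; lra.
Qed.

Section bayes.
Context (R : realType) (dT dA dX : measure_display).
Context (Theta : measurableType dT) (A : measurableType dA) (X : measurableType dX).
Context (P : Theta -> probability X R) (w : probability Theta R) (L : Theta -> A -> R).
Hypothesis P_meas : forall U : set X, measurable U ->
  measurable_fun [set: Theta] (fun theta => P theta U).
Hypothesis L_ge0 : forall theta a, (0 <= L theta a)%R.
Hypothesis L_meas : measurable_fun [set: Theta * A] (fun z : Theta * A => L z.1 z.2).

Definition large_loss (delta : X -> A) (t : R) : set (Theta * X) :=
  [set z | (t <= L z.1 (delta z.2))%R].

Lemma measurable_large_loss (delta : X -> A) (t : R) :
  measurable_fun setT delta -> measurable (large_loss delta t).
Proof.
move=> mdelta.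
have mpair : measurable_fun setT (fun z : Theta * X => (z.1, delta z.2)).
  apply: measurable_fun_pair; first exact: measurable_fst.
  exact: measurableT_comp mdelta measurable_snd.
have mLd := measurableT_comp L_meas mpair.
by rewrite -[large_loss _ _]setTI; exact: measurable_fun_le.
Qed.

(** Markov's inequality, for each [theta], averaged over the prior. *)
Lemma risk_ge (delta : X -> A) (t : R) : measurable_fun setT delta -> (0 <= t)%R ->
  t%:E * \int[w]_theta P theta (xsection (large_loss delta t) theta) <=
  \int[w]_theta \int[P theta]_x (L theta (delta x))%:E.
Proof.
move=> mdelta t0; have mE := measurable_large_loss t mdelta.
rewrite -ge0_integralZl//; last exact: measurable_prob_xsection.
apply: le_integral_nonmeasurable => theta.
set E := xsection _ _.
have mEt : measurable E by exact: measurable_xsection.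
have -> : P theta E = \int[P theta]_x (\1_E x)%:E.
  by rewrite integral_indic// setIT.
rewrite -ge0_integralZl//; last exact/measurable_EFinP/measurable_indic.
apply: le_integral_nonmeasurable => x.
rewrite -EFinM lee_fin indicE; have [xE|xE] := boolP (x \in E).
  by rewrite mulr1; move: xE; rewrite inE => /xsectionP.
by rewrite mulr0.
Qed.

End bayes.

Theorem theorem4p1 (R : realType) (dT dA dX : measure_display)
    (Theta : measurableType dT) (A : measurableType dA)
    (X : measurableType dX)
    (P : Theta -> probability X R)
    (P_meas : forall U : set X, measurable U ->
       measurable_fun [set: Theta] (fun theta => P theta U))
    (L : Theta -> A -> R)
    (L_ge0 : forall theta a, (0 <= L theta a)%R)
    (L_meas : measurable_fun [set: Theta * A]
       (fun z : Theta * A => L z.1 z.2))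
    (w : probability Theta R)
    (f : R -> R)
    (f_convex : @convex_function R R^o [set x : R | (0 < x)%R] f)
    (f1 : f 1%R = 0%R) :
  (2^-1)%:E *
    esup0 [set t%:E | t in [set t : R | (0 < t)%R /\
      esup0 [set w (loss_ball L t a) | a in [set: A]]
        < 1 - (u_f f (f_informativity f w P))%:E]]
  <= bayes_risk P w L.
Proof.
apply: le_ereal_inf_tmp => _ [delta mdelta <-].
set risk := (X in _ <= X).
have risk_ge0 : 0 <= risk.
  by apply: integral_ge0 => theta _; apply: integral_ge0 => x _; rewrite lee_fin.
rewrite lee_pdivrMl//.
apply: esup0_le => [|_ [t [t_gt0 ball_small] <-]].
  by rewrite mule_ge0// lee_fin.
have ball_ge0 : 0 <= esup0 [set w (loss_ball L t a) | a in [set: A]].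
  by apply: esup0_ge0 => _ [a _ <-].
have [b [b_itv b_gt ball_le]] := u_f_lt_exists ball_ge0 ball_small.
pose E := large_loss L delta t.
have mE : measurable E by exact: measurable_large_loss.
have prob01 d' (T : measurableType d') (S : probability T R) (B : set T) :
    measurable B -> 0 <= S B <= 1.
  by move=> mB; rewrite measure_ge0 probability_le1.
have intP : w.-integrable setT (fun theta => P theta (xsection E theta)).
  apply: integrable_probability; first exact: measurable_prob_xsection.
  by move=> theta; apply: prob01; exact: measurable_xsection.
have intQ (Q : probability X R) : Q.-integrable setT (fun x => w (ysection E x)).
  apply: integrable_probability; first exact: measurable_fun_ysection.
  by move=> x; apply: prob01; exact: measurable_ysection.
pose r := fine (\int[w]_theta P theta (xsection E theta)).
have Er : \int[w]_theta P theta (xsection E theta) = r%:E.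
  by rewrite fineK//; exact: integrable_fin_num.
(* Under any Q, theta is independent of x: given x, the action is fixed and
   the prior mass of its ball is at most 1 - b. *)
have w_ge x : b%:E <= w (ysection E x).
  have -> : ysection E x = ~` loss_ball L t (delta x).
    apply/seteqP; split => theta; rewrite ysectionE /E /large_loss /loss_ball /=.
      by rewrite leNgt => /negP.
    by move=> /negP; rewrite -leNgt.
  have mball : measurable (loss_ball L t (delta x)).
    have -> : loss_ball L t (delta x) = ~` ysection E x.
      apply/seteqP; split => theta; rewrite ysectionE /E /large_loss /loss_ball /=.
        by rewrite ltNge => /negP.
      by move=> /negP; rewrite -ltNge.
    by apply: measurableC; exact: measurable_ysection.
  have : w (loss_ball L t (delta x)) <= (1 - b)%:E.
    by apply: le_trans ball_le; apply: esup0_ubound; exists (delta x).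
  rewrite probability_setC//.
  have : w (loss_ball L t (delta x)) \is a fin_num by rewrite fin_num_measure.
  case: (w _) => [v||]// _; rewrite !lee_fin; lra.
have r_ge : (2^-1 <= r)%R.
  rewrite leNgt; apply/negP => r_lt.
  have : phi f 2^-1 b <= f_informativity f w P.
    apply: le_ereal_inf_tmp => _ [Q _ <-].
    pose s := fine (\int[Q]_x w (ysection E x)).
    have Es : \int[Q]_x w (ysection E x) = s%:E.
      by rewrite fineK//; exact: (integrable_fin_num measurableT (intQ Q)).
    apply: (expected_f_divergence_ge_phi P_meas f_convex f1 b_itv mE Er Es (ltW r_lt)).
    rewrite -lee_fin -Es.
    have -> : b%:E = \int[Q]_x (cst b%:E) x.
      by rewrite integral_cst// -[LHS]mule1; congr (_ * _); exact: esym (probability_setT Q).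
    exact: le_integral_nonmeasurable.
  by rewrite leNgt b_gt.
have := risk_ge w P_meas L_ge0 L_meas mdelta (ltW t_gt0).
rewrite -/E Er -/risk => /(lee_wpmul2l (_ : 0 <= 2%:E)); rewrite lee_fin => /(_ (ler0n _ _)).
apply: le_trans; rewrite -!EFinM lee_fin mulrCA ler_peMr//; lra.
Qed.
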